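(* Let $d\ge 3$ be a fixed positive integer. Let $X=X_\tau$ be a family of distance regular graphs of diameter $d$, for which the number of vertices $n=n(\tau)$, the valency $k=k(\tau)$, and the intersection numbers $a_i(\tau),b_i(\tau),c_i(\tau)$ are all functions of a parameter $\tau$ ranging over an unbounded set of positive numbers, and $k(\tau)$ increases in $\tau$. Further assume $$\lim_{\tau\to\infty}\frac{k(\tau)^{d-1}}{c_2(\tau)\cdots c_d(\tau)\,n(\tau)}=0.$$ Let $a$ be any vertex of $X$ (the marked vertex). Then, as the valency $k(\tau)$ goes to infinity (with $\tau\to\infty$), the average search probability on $X$ approaches $1/4$.
   Context: Graphs are finite and simple. A connected graph is distance regular if for any two vertices $u,v$ at distance $m$, the number of vertices at distance $i$ from $u$ and distance $j$ from $v$ depends only on $i,j,m$. For a distance regular graph of diameter $d$ and any two vertices $u,v$ at distance $i$, the intersection numbers $c_i$, $a_i$, $b_i$ are the numbers of neighbors of $v$ at distance $i-1$, $i$, $i+1$ from $u$, respectively. Quantum walk: let $X$ be a $k$-regular graph on $n$ vertices with marked vertex $a$. View each edge $\{u,v\}$ as two arcs $(u,v),(v,u)$ and consider complex functions on the $nk$ arcs, identified with $\mathbb{C}^n\otimes\mathbb{C}^k$ by grouping arcs by tail. Let $R$ be the permutation matrix swapping $(u,v)$ and $(v,u)$, $C=I_n\otimes(\frac2kJ_k-I_k)$ (i.e. $(Cf)(u,v)=\frac2k\sum_{w\sim u}f(u,w)-f(u,v)$), and $O_a=(I_n-2E_{aa})\otimes I_k$ (i.e. $O_a$ multiplies $f(u,v)$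 by $-1$ if $u=a$ and by $1$ otherwise). The transition matrix is $U=RCO_a$ and the initial state is $x_0=\frac{1}{\sqrt{nk}}\mathbf{1}_{nk}$, where $\mathbf 1_{nk}$ is the all-ones vector. If $F_r$ are the orthogonal projections onto the eigenspaces of $U$ (one for each distinct eigenvalue), the average search probability is $$\sum_{v\sim a}\sum_r\big|e_{(a,v)}^TF_rx_0\big|^2,$$ which equals $\lim_{T\to\infty}\frac1T\sum_{t=0}^{T-1}\sum_{v\sim a}|e_{(a,v)}^TU^tx_0|^2$. *)

(* Defs.v *)
From mathcomp Require Import all_boot all_order all_algebra.
From mathcomp.real_closed Require Import complex.
From mathcomp Require Import all_classical all_reals all_analysis.

Set Implicit Arguments.
Unset Strict Implicit.
Unset Printing Implicit Defensive.

Import Order.TTheory GRing.Theory Num.Theory.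
Import numFieldNormedType.Exports.

Local Open Scope ring_scope.
Local Open Scope classical_set_scope.
Local Open Scope complex_scope.

Record sgraph := SGraph {
  vertex :> finType;
  adj : rel vertex;
  adj_sym : symmetric adj;
  adj_irr : irreflexive adj }.

Section Graphs.
Variable G : sgraph.
Implicit Types u v w : G.

(* Least length of a walk from u to v; a shortest walk has fewer than #|G|
   edges, so the search range suffices. The value is #|G| when v is not
   reachable from u. *)
Definition gdist u v : nat :=
  find (fun m : nat =>
          [exists p : m.-tuple G, path (@adj G) u p && (last u p == v)])
       (iota 0 #|G|).

Definition connected_graph : Prop := forall u v, connect (@adj G) u v.

Definition diameter : nat := \max_(u : G) \max_(v : G) gdist u v.

Definition regular (k : nat) : Prop := forall u, #|[set w | adj u w]%SET| = k.

Definition distance_regular : Prop :=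
  connected_graph /\
  exists p : nat -> nat -> nat -> nat, forall i j u v,
    #|[set w | (gdist u w == i) && (gdist v w == j)]%SET| = p i j (gdist u v).

(* c_i, a_i and b_i, each a function of i. The successor in the first clause
   makes c_0 = 0. Values at indices above the diameter are unconstrained. *)
Definition intersection_numbers (c a b : nat -> nat) : Prop :=
  forall u v,
  [/\ #|[set w | adj v w && ((gdist u w).+1 == gdist u v)]%SET| = c (gdist u v),
      #|[set w | adj v w && (gdist u w == gdist u v)]%SET| = a (gdist u v) &
      #|[set w | adj v w && (gdist u w == (gdist u v).+1)]%SET|
        = b (gdist u v)].

Definition darc : finType := {p : G * G | adj p.1 p.2}.

Definition tail (x : darc) : G := (sval x).1.
Definition head (x : darc) : G := (sval x).2.

End Graphs.

Section QuantumWalk.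
Variables (R : realType) (G : sgraph) (k : nat) (a : G).

(* Matrices act on column vectors; rows and columns are indexed by arcs
   through the enumeration enum_val. *)
Local Notation n_arcs := #|darc G|.
Local Notation arc_of := (@enum_val (darc G) predT).

Definition arc_reversal : 'M[R[i]]_n_arcs :=
  \matrix_(x, y) ((tail (arc_of x) == head (arc_of y)) &&
                  (head (arc_of x) == tail (arc_of y)))%:R.

Definition coin : 'M[R[i]]_n_arcs :=
  \matrix_(x, y) if tail (arc_of x) == tail (arc_of y)
                 then 2 / k%:R - (x == y)%:R else 0.

Definition oracle : 'M[R[i]]_n_arcs :=
  \matrix_(x, y) if x == y then (if tail (arc_of x) == a then -1 else 1) else 0.

Definition transition : 'M[R[i]]_n_arcs := arc_reversal *m coin *m oracle.

Definition initial_state : 'cV[R[i]]_n_arcs :=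
  const_mx ((Num.sqrt ((#|G| * k)%N%:R : R))^-1)%:C.

(* Orthogonal projection onto {x | U *m x = l *: x}. MathComp's eigenspaces and
   projections act on row vectors, whence the two transpositions. *)
Definition eigenprojection n (U : 'M[R[i]]_n) (l : R[i]) : 'M[R[i]]_n :=
  (proj_ortho (eigenspace U^T l))^T.

Definition avg_search_prob : R :=
  \sum_(x < n_arcs | tail (arc_of x) == a)
   \sum_(l \in [set l | eigenvalue transition l])
     Normc.normc ((eigenprojection transition l *m initial_state) x ord0) ^+ 2.

End QuantumWalk.

(* Main.v *)
Require Import Defs.
From mathcomp Require Import all_boot all_order all_algebra.
From mathcomp.real_closed Require Import complex.
From mathcomp Require Import all_classical all_reals all_analysis.
From mathcomp Require Import ring lra zify.

Set Implicit Arguments.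
Unset Strict Implicit.
Unset Printing Implicit Defensive.

Import Order.TTheory GRing.Theory Num.Theory.
Import numFieldNormedType.Exports.

Local Open Scope ring_scope.
Local Open Scope classical_set_scope.

(** Write n for the number of vertices, k for the valency, A for the adjacency
    matrix, U for the transition matrix and o for the marked vertex.

    Suppose that a real function F on the vertices vanishes at o, takes a single
    value f1 on the neighbours of o, and satisfies A F = k mu F away from o: it
    is an eigenfunction of the random walk killed at o.  The arc functions
    Tl (u, v) = F u and Hd (u, v) = F v then satisfy U Tl = Hd and
    U Hd = 2 mu Hd - Tl ([transition_tail], [transition_head]).  Thus they span
    an invariant plane on which U has the eigenvalues z, z' = mu +- i s with
    s^2 = 1 - mu^2, and Tl is the difference of the eigenvectors Hd - z' Tl and
    Hd - z Tl divided by 2 i s.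

    If moreover F is close to 1 away from o, the initial state is close to
    Tl / sqrt (n k) ([energy_defect]).  By Bessel's inequality for the
    eigenspaces of U ([sum_energy_eigenprojection]) the small difference has a
    small effect on the average search probability
    ([eigenprojection_perturb]), which is therefore close to the contribution
    of the two eigenvectors on the arcs leaving o.  That contribution is
    f1^2 / (2 n (1 - mu^2)).  Summing A F over all vertices, with k f1 as the
    term at o, gives f1 = (1 - mu) * sum F; so n (1 - mu) is close to 1 and the
    contribution is close to 1/4 ([main_term_bounds]).

    The function F is sought among the functions of the distance to o.  With K_i
    vertices at distance i and e = 1 - mu, the eigenvalue equation integrates to
    the flux equations
    K_i b_i (f_{i+1} - f_i) = k e * sum_{l > i} K_l f_l.
    For 1 <= i < l the coefficients obey
    k K_l / (K_i b_i) <= k^(d-1) / (c_2 ... c_d) ([level_ratio_le]), and the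
    right-hand side is n times the ratio that is assumed to vanish.  As e is at
    most 2 / (n - 1), the values f_1, ..., f_d differ by a vanishing amount.
    A shooting argument with the intermediate value theorem produces a solution
    with f_0 = 0 ([radial_profile]).

    The outcome is an explicit estimate for each single graph,
    [search_prob_near_quarter]: the average search probability differs from 1/4
    by at most 2 (s + sqrt s), where s is 1/n plus 4 d^2 times the ratio. *)

(** * Distances in a connected graph *)

Section Distance.
Variable G : sgraph.
Implicit Types u v w : G.

Lemma gdist_le_walk u (p : seq G) :
  path (@adj G) u p -> (gdist u (last u p) <= size p)%N.
Proof.
move=> up; rewrite /gdist leqNgt; apply/negP => lt_p.
have /(before_find 0%N) := lt_p.
have le_p : (size p < #|G|)%N.
  by apply: leq_trans lt_p _; rewrite -[leqRHS](size_iota 0) find_size.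
rewrite nth_iota //= add0n => /existsP[]; exists (in_tuple p).
by rewrite up eqxx.
Qed.

Hypothesis conn : connected_graph G.

(** A walk without repeated vertices has fewer than #|G| edges, so the bounded
    search in [gdist] succeeds on a connected graph. *)
Lemma gdist_walk u v :
  exists2 p : seq G, path (@adj G) u p & (last u p = v) /\ size p = gdist u v.
Proof.
have /connectP[p0 up0 vE] := conn u v.
case/shortenP: up0 vE => p up uniq_p _ vE.
have lt_p : (size p < #|G|)%N.
  by rewrite -[X in (X <= _)%N](card_uniqP uniq_p) max_card.
have : has (fun m : nat => [exists p : m.-tuple G,
    path (@adj G) u p && (last u p == v)]) (iota 0 #|G|).
  apply/hasP; exists (size p); first by rewrite mem_iota.
  by apply/existsP; exists (in_tuple p); rewrite up vE eqxx.
move=> hs; have := hs; rewrite has_find size_iota => lt_f.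
have /existsP[q /andP[uq /eqP qv]] := nth_find 0%N hs.
exists q => //; split => //.
by rewrite size_tuple nth_iota.
Qed.

Lemma gdist_eq0 u v : (gdist u v == 0%N) = (v == u).
Proof.
apply/eqP/eqP => [d0|->].
  by have [p _ [pv ps]] := gdist_walk u v; rewrite -pv (size0nil (etrans ps d0)).
by apply/eqP; rewrite -leqn0; apply: (@gdist_le_walk u [::]).
Qed.

Lemma gdist_adj u v w : adj v w -> (gdist u w <= (gdist u v).+1)%N.
Proof.
move=> vw; have [p up [pv <-]] := gdist_walk u v.
rewrite -(size_rcons p w) -[X in gdist u X](last_rcons u p w).
by apply: gdist_le_walk; rewrite rcons_path up pv.
Qed.

Lemma gdist_pred u v : (0 < gdist u v)%N ->
  exists2 w, adj v w & (gdist u w).+1 = gdist u v.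
Proof.
have [p + [pv ps]] := gdist_walk u v; rewrite -ps.
case/lastP: p pv ps => // p x; rewrite last_rcons size_rcons => -> ps.
rewrite rcons_path => /andP[up wv] _; exists (last u p); first by rewrite adj_sym.
apply/eqP; rewrite eqSS eqn_leq gdist_le_walk //=.
by rewrite -ltnS ps gdist_adj.
Qed.

Lemma gdist_diameter u v : (gdist u v <= diameter G)%N.
Proof.
rewrite /diameter (leq_trans _ (leq_bigmax u)) //.
exact: (leq_bigmax (F := fun v => gdist u v) v).
Qed.

Lemma diameterP : (0 < diameter G)%N -> exists u v, gdist u v = diameter G.
Proof.
move=> d_gt0; have [u0] : exists u : G, true.
  move: d_gt0; rewrite /diameter.
  case: (pickP (@predT G)) => [u _|G0]; first by exists u.
  by rewrite big_pred0.
move=> _; have G0 : (0 < #|G|)%N by apply/card_gt0P; exists u0.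
have [u uE] := @bigop.eq_bigmax G (fun u : G => \max_(v : G) gdist u v) G0.
have [v vE] := @bigop.eq_bigmax G (fun v : G => gdist u v) G0.
by exists u, v; rewrite /diameter uE vE.
Qed.

Lemma gdist_intermediate u v i : (i <= gdist u v)%N -> exists w, gdist u w = i.
Proof.
move=> le_i; have [m mE] : exists m, (i + m)%N = gdist u v.
  by exists (gdist u v - i)%N; rewrite subnKC.
elim: m v mE {le_i} => [|m IHm] v; first by exists v; rewrite addn0 in mE *.
move=> mE; have [|w _ wE] := @gdist_pred u v; first by rewrite -mE addnS.
by apply: (IHm w); apply/eqP; rewrite -eqSS wE -mE addnS.
Qed.

End Distance.

(** * Intersection numbers and distance levels *)

Section Levels.
Variables (G : sgraph) (k : nat) (c a b : nat -> nat).
Hypothesis conn : connected_graph G.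
Hypothesis reg : regular G k.
Hypothesis inter : intersection_numbers G c a b.
Local Notation d := (diameter G).
Hypothesis d_gt0 : (0 < d)%N.

Definition level (o : G) i := #|[set v | gdist o v == i]%SET|.

Lemma dist_realized i : (i <= d)%N -> exists u v : G, gdist u v = i.
Proof.
have [u [v uv]] := diameterP d_gt0; rewrite -uv => le_i.
by have [w wE] := gdist_intermediate conn le_i; exists u, w.
Qed.

Lemma inter_c_gt0 i : (0 < i <= d)%N -> (0 < c i)%N.
Proof.
case/andP=> i_gt0 /dist_realized[u [v uv]].
have [cE _ _] := inter u v; rewrite -uv -cE; apply/card_gt0P.
have [|w vw wE] := @gdist_pred _ conn u v; first by rewrite uv.
by exists w; rewrite inE vw wE eqxx.
Qed.

Lemma inter_b_gt0 i : (i < d)%N -> (0 < b i)%N.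
Proof.
move=> /dist_realized[u [v uv]].
have [|w vw wE] := @gdist_pred _ conn u v; first by rewrite uv.
have uw : gdist u w = i by apply/eqP; rewrite -eqSS wE uv.
have [_ _ bE] := inter u w; rewrite -uw -bE; apply/card_gt0P.
by exists v; rewrite inE adj_sym vw wE eqxx.
Qed.

Lemma inter_sum i : (i <= d)%N -> (c i + a i + b i)%N = k.
Proof.
move=> /dist_realized[u [v uv]].
have [cE aE bE] := inter u v; rewrite -uv -cE -aE -bE -(reg v).
have cardE (A : {set G}) : #|A| = (\sum_w (w \in A))%N.
  by rewrite -sum1_card big_mkcond; apply: eq_bigr => w _; case: (w \in A).
rewrite !cardE -!big_split /=; apply: eq_bigr => w _; rewrite !inE.
case: (boolP (adj v w)) => //= vw.
have := gdist_adj conn u vw; rewrite adj_sym in vw.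
have := gdist_adj conn u vw; move: (gdist u w) (gdist u v) => m n mn nm.
by do ![case: eqP => ?] => /=; lia.
Qed.

Lemma inter_c_le i : (i <= d)%N -> (c i <= k)%N.
Proof. by move=> /inter_sum <-; rewrite -addnA leq_addr. Qed.

Lemma inter_b_le i : (i <= d)%N -> (b i <= k)%N.
Proof. by move=> /inter_sum <-; rewrite leq_addl. Qed.

Lemma inter_b_diameter : b d = 0%N.
Proof.
have [u [v uv]] := dist_realized (leqnn d).
have [_ _ bE] := inter u v; rewrite -uv -bE; apply/eqP; rewrite cards_eq0.
apply/eqP/setP=> w; rewrite !inE; apply/negP => /andP[_ /eqP uw].
by have := gdist_diameter u w; rewrite uw uv ltnn.
Qed.

Variable o : G.

Lemma level0 : level o 0 = 1%N.
Proof.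
rewrite /level -(cards1 o); congr #|pred_of_set _|.
by apply/setP=> v; rewrite !inE gdist_eq0.
Qed.

Lemma inter_b0 : b 0 = k.
Proof.
have o0 : gdist o o = 0%N by apply/eqP; rewrite gdist_eq0.
have [_ _ bE] := inter o o; rewrite o0 in bE; rewrite -bE -(reg o).
congr #|pred_of_set _|; apply/setP=> w; rewrite !inE andb_idr // => ow.
have := gdist_adj conn o ow; rewrite o0 eqn_leq => -> /=; rewrite lt0n gdist_eq0 //.
by apply: contraL ow => /eqP ->; rewrite adj_irr.
Qed.

(** Double counting of the edges between levels i and i+1. *)
Lemma level_flux i : (level o i * b i = level o i.+1 * c i.+1)%N.
Proof.
transitivity (\sum_(v | gdist o v == i) \sum_(w | adj v w && (gdist o w == i.+1)) 1)%N.
  under eq_bigr => v /eqP vi.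
    rewrite sum1_card; have [_ _] := inter o v; rewrite vi cardsE => ->; over.
  by rewrite sum_nat_const /level cardsE.
transitivity (\sum_(w | gdist o w == i.+1) \sum_(v | adj w v && (gdist o v == i)) 1)%N.
  rewrite (exchange_big_dep (fun w => gdist o w == i.+1)) /=; last by move=> ? ? _ /andP[].
  apply: eq_bigr => w wi; apply: eq_bigl => v.
  by rewrite wi andbT adj_sym andbC.
under eq_bigr => w /eqP wi.
  rewrite sum1_card; have [+ _ _] := inter o w; rewrite wi cardsE => cE.
  have -> : #|[pred v | adj w v & gdist o v == i]| = c i.+1 by rewrite -cE; apply: eq_card.
  over.
by rewrite sum_nat_const /level cardsE.
Qed.

Lemma level_gt0 i : (i <= d)%N -> (0 < level o i)%N.
Proof.
elim: i => [|i IHi] id; first by rewrite level0.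
have := level_flux i; have := IHi (ltnW id); have := inter_b_gt0 id.
by case: (level o i.+1) => //; rewrite mul0n; case: (level o i) => //; case: (b i).
Qed.

Lemma sum_level (V : nmodType) (f : nat -> V) :
  \sum_v f (gdist o v) = \sum_(i < d.+1) f i *+ level o i.
Proof.
rewrite (partition_big (fun v => inord (gdist o v) : 'I_d.+1) predT) //=.
apply: eq_bigr => i _.
have E v : (inord (gdist o v) == i) = (gdist o v == i).
  by rewrite -val_eqE /= inordK // ltnS gdist_diameter.
under eq_bigl do rewrite E.
rewrite (eq_bigr (fun=> f i)) => [|v /eqP -> //].
by rewrite big_const iter_addr_0 /level cardsE.
Qed.

Lemma card_levels : #|G| = (\sum_(i < d.+1) level o i)%N.
Proof.
rewrite -sum1_card (sum_level (fun=> 1%N)).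
apply: eq_bigr => i _; rewrite -[RHS]muln1 mulnC.
by elim: (level o i) => // m IH; rewrite mulrS IH.
Qed.

Lemma sum_neighbors (V : nmodType) (f : nat -> V) v i : gdist o v = i ->
  \sum_(w | adj v w) f (gdist o w) = f i.-1 *+ c i + f i *+ a i + f i.+1 *+ b i.
Proof.
move=> vi; have [cE aE bE] := inter o v; rewrite vi in cE aE bE.
rewrite -cE -aE -bE -!sumr_const big_mkcond.
have mkcond (P : pred G) x : \sum_(w in [set w | adj v w & P w]%SET) x =
    \sum_w (if adj v w && P w then x else 0 : V).
  by rewrite big_mkcond; apply: eq_bigr => w _; rewrite inE.
rewrite !mkcond -!big_split /=.
apply: eq_bigr => w _.
case: (boolP (adj v w)) => /= vw; last by rewrite !addr0.
have := gdist_adj conn o vw; rewrite adj_sym in vw.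
have := gdist_adj conn o vw; rewrite vi; move: (gdist o w) => m mn nm.
by do 3 ?[case: eqP => ?] => //=; rewrite ?addr0 ?add0r; try congr f; lia.
Qed.

End Levels.

(** * Solving the flux equations by shooting *)

Section Shooting.
Variables (R : rcfType) (d : nat) (K kap : nat -> R).

(** Since the flux through the edges below level i + 1 involves the levels
    above i, the recursion runs inwards: [shoot m] holds the value at level
    d - m and the weighted sum of the values from there outwards, both as
    polynomials in e. *)
Fixpoint shoot m : {poly R} * {poly R} :=
  if m is m'.+1 then
    let: (f, s) := shoot m' in
    let f' := f - kap (d - m) *: ('X * s) in (f', s + K (d - m) *: f')
  else (1, (K d)%:P).

Lemma shoot_sum e m : (m <= d)%N ->
  (shoot m).2.[e] = \sum_((d - m) <= l < d.+1) K l * (shoot (d - l)).1.[e].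
Proof.
elim: m => [|m IHm] md.
  by rewrite subn0 big_nat1 subnn /= !hornerE.
rewrite big_ltn; last by rewrite ltnS leq_subr.
have -> : (d - m.+1).+1 = (d - m)%N by lia.
have -> : (d - (d - m.+1))%N = m.+1 by lia.
rewrite -IHm; last by lia.
by move=> /=; case: (shoot m) => f s /=; rewrite !hornerE addrC.
Qed.

Lemma shoot_step e i : (i < d)%N ->
  (shoot (d - i)).1.[e] = (shoot (d - i.+1)).1.[e] -
     e * kap i * \sum_(i.+1 <= l < d.+1) K l * (shoot (d - l)).1.[e].
Proof.
move=> id; have -> : (d - i)%N = (d - i.+1).+1 by lia.
have := @shoot_sum e (d - i.+1); rewrite leq_subr subKn // => <- //=.
have -> : (d - (d - i.+1).+1)%N = i by lia.
by case: (shoot _) => f s /=; rewrite hornerD hornerN hornerZ hornerM hornerX; ring.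
Qed.

Hypotheses (K_ge0 : forall i, 0 <= K i) (kap_ge0 : forall i, 0 <= kap i).
Variables (beta : R).
Hypotheses (beta_ge0 : 0 <= beta).
Hypothesis tail_le : forall i, (0 < i < d)%N ->
  kap i * (\sum_(i.+1 <= l < d.+1) K l) <= beta.

Lemma shoot_bounds (e : R) m : (m < d)%N -> 0 <= e -> e * d%:R * beta <= 1 ->
  1 - e * m%:R * beta <= (shoot m).1.[e] <= 1 /\
  0 <= (shoot m).2.[e] <= \sum_((d - m) <= l < d.+1) K l.
Proof.
move=> md e_ge0 eb_le1; elim: m md => [|m IHm] md.
  by rewrite subn0 big_nat1 /= !hornerC K_ge0 mulr0 mul0r subr0 !lexx.
have [/andP[f_ge f_le] /andP[s_ge0 s_le]] := IHm (ltnW md).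
have /tail_le : (0 < d - m.+1 < d)%N by lia.
have dE : (d - m.+1).+1 = (d - m)%N by lia.
rewrite dE => t_le.
rewrite big_ltn ?dE; last by lia.
move: f_ge f_le s_ge0 s_le => /=; case: (shoot m) => f s /=.
rewrite !(hornerD, hornerN, hornerZ, hornerM, hornerX).
move: f.[e] s.[e] => {}f {}s f_ge f_le s_ge0 s_le.
set kk := kap (d - m.+1) in t_le *.
have kkS : 0 <= kk * s <= beta.
  rewrite mulr_ge0 ?kap_ge0 //=; apply: le_trans t_le.
  by rewrite ler_wpM2l ?kap_ge0.
have [ekS_ge0 ekS_le] : 0 <= e * (kk * s) /\ e * (kk * s) <= e * beta.
  by case/andP: kkS => ? ?; rewrite mulr_ge0 // ler_wpM2l.
have -> : kk * (e * s) = e * (kk * s) by ring.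
set f' := f - _.
have f'_bd : 1 - e * m.+1%:R * beta <= f' <= 1.
  by rewrite /f' -natr1; apply/andP; split; nra.
have f'_ge0 : 0 <= f'.
  have : e * m.+1%:R * beta <= e * d%:R * beta.
    by rewrite ler_wpM2r // ler_wpM2l // ler_nat ltnW.
  by case/andP: f'_bd => ? ? ?; lra.
split => //; case/andP: f'_bd => _ f'_le.
have := K_ge0 (d - m.+1); set kd := K _ => kd_ge0.
have : 0 <= kd * f' <= kd by rewrite mulr_ge0 //= ler_piMr.
by case/andP=> ? ?; apply/andP; split; lra.
Qed.

(** With the value at level d set to 1, the flux equations determine the value
    at level 0 as a polynomial in the eigenvalue e.  It is 1 at e = 0.  As long
    as e <= 2 / M the values at the levels 1, ..., d stay above 1 - delta, hence
    above 1/2, so at e = 2 / M the last flux equation makes the value at level 0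
    nonpositive.  An intermediate root is the eigenvalue. *)
Lemma radial_profile M delta :
    (0 < d)%N -> \sum_(1 <= l < d.+1) K l = M -> 0 < M -> kap 0 = 1 ->
    2 * d%:R * beta <= delta * M -> delta < 1 / 2 ->
  exists (e : R) (f : nat -> R), [/\ 0 < e <= 2 / M, f 0%N = 0,
    forall i, (0 < i <= d)%N -> 1 - delta <= f i <= 1 &
    forall i, (i < d)%N ->
      f i.+1 - f i = e * kap i * \sum_(i.+1 <= l < d.+1) K l * f l].
Proof.
move=> d_gt0 sumK M_gt0 kap0 delta_ge delta_lt.
have ebound (e : R) : e <= 2 / M -> e * d%:R * beta <= delta.
  move=> e_le; rewrite -mulrA -(ler_pM2r M_gt0); apply: le_trans delta_ge.
  rewrite mulrAC -[2 * _ * _]mulrA ler_wpM2r ?mulr_ge0 ?ler0n //.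
  by rewrite -ler_pdivlMr.
have fbound (e : R) i : 0 <= e <= 2 / M -> (0 < i <= d)%N ->
    1 - delta <= (shoot (d - i)).1.[e] <= 1.
  case/andP=> e_ge0 /ebound e_le /andP[i_gt0 id].
  have [||| /andP[h1 h2] _] := @shoot_bounds e (d - i); first by lia.
  - by [].
  - by apply: le_trans e_le _; lra.
  rewrite h2 andbT; apply: le_trans h1; rewrite lerD2l lerN2.
  apply: le_trans e_le; rewrite ler_wpM2r // ler_wpM2l // ler_nat; lia.
pose p := - (shoot d).1.
have pE (e : R) : p.[e] = e * (\sum_(1 <= l < d.+1) K l * (shoot (d - l)).1.[e]) -
    (shoot (d - 1)).1.[e].
  by have := shoot_step e d_gt0; rewrite /p hornerN subn0 kap0 => ->; ring.
have M2_ge0 : 0 <= 2 / M by rewrite divr_ge0 ?ltW.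
have p0 : p.[0] <= 0.
  rewrite pE mul0r sub0r oppr_le0.
  have /andP[+ _] : 1 - delta <= (shoot (d - 1)).1.[0] <= 1.
    by apply: fbound; rewrite ?lexx.
  by apply: le_trans; lra.
have p1 : 0 <= p.[2 / M].
  rewrite pE subr_ge0.
  have /andP[_ ?] : 1 - delta <= (shoot (d - 1)).1.[2 / M] <= 1.
    by apply: fbound; rewrite ?lexx ?M2_ge0.
  have : M * (1 - delta) <= \sum_(1 <= l < d.+1) K l * (shoot (d - l)).1.[2 / M].
    rewrite -[X in X * _]sumK mulr_suml ler_sum_nat // => l ld; rewrite ler_wpM2l //.
    have /andP[] // : 1 - delta <= (shoot (d - l)).1.[2 / M] <= 1.
    by apply: fbound; rewrite ?lexx ?M2_ge0.
  move/(ler_wpM2l M2_ge0); apply: le_trans.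
  by rewrite mulrA divfK ?gt_eqF //; lra.
have [||e e_bd /rootP pe0] := @Num.poly_ivt R p 0 (2 / M); rewrite ?p0 //.
exists e, (fun i => (shoot (d - i)).1.[e]); split.
- case/andP: (e_bd) => e_ge0 ->; rewrite andbT lt_neqAle eq_sym e_ge0 andbT.
  apply: contra_eq_neq pe0 => ->.
  rewrite pE mul0r sub0r oppr_eq0 gt_eqF //.
  have /andP[+ _] : 1 - delta <= (shoot (d - 1)).1.[0] <= 1.
    by apply: fbound; rewrite ?lexx.
  by apply: lt_le_trans; lra.
- by rewrite subn0 -[_.[_]]opprK -hornerN -/p pe0 oppr0.
- by move=> i id; apply: fbound.
by move=> i id; rewrite (@shoot_step e i) //; ring.
Qed.

End Shooting.

(** * The ground state of the killed random walk *)

Section DirichletProfile.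
Variables (R : realType) (G : sgraph) (k : nat) (c a b : nat -> nat).
Hypothesis conn : connected_graph G.
Hypothesis reg : regular G k.
Hypothesis inter : intersection_numbers G c a b.
Local Notation d := (diameter G).
Hypothesis d_gt0 : (0 < d)%N.
Variable o : G.
Local Notation K := (level o).

Lemma level_prod_le i l : (i < l <= d)%N ->
  (K l * \prod_(i.+1 <= j < l.+1) c j <= K i * b i * k ^ (l - i.+1))%N.
Proof.
elim: l => // l IHl /andP[]; rewrite ltnS leq_eqVlt => /predU1P[->|il] ld.
  by rewrite big_nat1 subnn muln1 (level_flux inter).
rewrite big_nat_recr; last by rewrite ltnS ltnW.
have -> : (l.+1 - i.+1)%N = (l - i.+1).+1 by lia.
rewrite mulnCA -(level_flux inter) (mulnC (K l)) mulnCA (mulnC _ (K l)) expnS.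
rewrite (mulnCA _ k) leq_mul ?IHl ?il ?(ltnW ld) //.
by rewrite (inter_b_le conn reg inter d_gt0) // ltnW.
Qed.

Lemma prod_c_le m n : (n <= d.+1)%N -> (\prod_(m <= j < n) c j <= k ^ (n - m))%N.
Proof.
move=> nd; rewrite -prod_nat_const_nat; rewrite big_nat_cond [leqRHS]big_nat_cond.
by apply: leq_prod => j /andP[/andP[_ jn] _]; apply: (inter_c_le conn reg inter d_gt0); lia.
Qed.

(** By the flux identity K_l / (K_i b_i) is a quotient of products,
    b_(i+1) ... b_(l-1) over c_(i+1) ... c_l.  Replacing each b_j by k and
    inserting the missing factors k / c_j >= 1 gives a bound independent of i
    and l. *)
Lemma level_ratio_le i l : (0 < i < l)%N -> (l <= d)%N ->
  (k * K l * \prod_(2 <= j < d.+1) c j <= k ^ (d - 1) * (K i * b i))%N.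
Proof.
case/andP=> i_gt0 il ld.
rewrite (@big_cat_nat _ _ _ i.+1) //=; try lia.
rewrite (@big_cat_nat _ _ _ l.+1 i.+1) //=; try lia.
have h1 : (\prod_(2 <= j < i.+1) c j <= k ^ (i.+1 - 2))%N by apply: prod_c_le; lia.
have h2 : (\prod_(l.+1 <= j < d.+1) c j <= k ^ (d.+1 - l.+1))%N by apply: prod_c_le; lia.
have h3 : (K l * \prod_(i.+1 <= j < l.+1) c j <= K i * b i * k ^ (l - i.+1))%N.
  by apply: level_prod_le; rewrite il ld.
have -> : (d - 1 = 1 + (i.+1 - 2) + (l - i.+1) + (d.+1 - l.+1))%N by lia.
rewrite !expnD expn1.
have := leq_mul h1 (leq_mul h3 h2) => /(leq_mul (leqnn k)).
move: {h1 h2 h3} (\prod_(2 <= j < i.+1) c j) (\prod_(i.+1 <= j < l.+1) c j).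
move: (\prod_(l.+1 <= j < d.+1) c j) => r p q.
have -> : (k * (p * (K l * q * r)) = k * K l * (p * (q * r)))%N by ring.
by move/leq_trans; apply; apply/eq_leq; ring.
Qed.

Local Notation n := #|G|.
Let ratio : R := k%:R ^+ (d - 1) / ((\prod_(2 <= i < d.+1) (c i)%:R) * n%:R).
Let kap i : R := k%:R / (K i * b i)%:R.

Lemma tail_resistance_le i : (0 < i < d)%N ->
  kap i * (\sum_(i.+1 <= l < d.+1) (K l)%:R) <= d%:R * (n%:R * ratio).
Proof.
case/andP=> i_gt0 id.
have P_gt0 : 0 < \prod_(2 <= j < d.+1) (c j)%:R :> R.
  rewrite big_nat_cond prodr_gt0 // => j; rewrite andbT => jd.
  by rewrite ltr0n (inter_c_gt0 conn inter d_gt0) //; lia.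
have n_gt0 : 0 < n%:R :> R by rewrite ltr0n; apply/card_gt0P; exists o.
have nrE : n%:R * ratio = k%:R ^+ (d - 1) / \prod_(2 <= j < d.+1) (c j)%:R.
  by rewrite /ratio; field; rewrite !gt_eqF.
have r_ge0 : 0 <= n%:R * ratio.
  by rewrite nrE divr_ge0 ?exprn_ge0 ?ler0n // ltW.
apply: (@le_trans _ _ (\sum_(i.+1 <= l < d.+1) n%:R * ratio)).
  rewrite mulr_sumr ler_sum_nat // => l /andP[il ld]; rewrite nrE.
  rewrite ler_pdivlMr // /kap (mulrAC k%:R) (mulrAC (k%:R * _)) ler_pdivrMr; last first.
    rewrite ltr0n muln_gt0 (inter_b_gt0 conn inter d_gt0) // andbT.
    by rewrite (level_gt0 conn inter d_gt0) // ltnW.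
  rewrite -natrX -natr_prod -!natrM ler_nat.
  by apply: level_ratio_le; rewrite ?i_gt0.
rewrite sumr_const_nat -[X in X <= _]mulr_natl ler_wpM2r // ler_nat; lia.
Qed.

(** The ground state of the random walk killed at o, with eigenvalue 1 - e.  The
    equation for f 1 is the balance of the mass lost at o; it ties e to n. *)
Lemma dirichlet_profile (delta := 4 * d%:R ^+ 2 * ratio) :
    (1 < n)%N -> delta < 1 / 2 ->
  exists (e : R) (f : nat -> R),
  [/\ 0 < e <= 2 / (n%:R - 1), f 0%N = 0,
      forall i, (0 < i <= d)%N -> 1 - delta <= f i <= 1,
      f 1%N = e * \sum_v f (gdist o v) &
      forall v, v != o ->
        \sum_(w | adj v w) f (gdist o w) = k%:R * (1 - e) * f (gdist o v)].
Proof.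
move=> n_gt1 delta_lt.
have ratio_ge0 : 0 <= ratio.
  by rewrite divr_ge0 ?exprn_ge0 ?mulr_ge0 ?prodr_ge0 ?ler0n.
have n2 : 2 <= n%:R :> R by rewrite ler_nat.
have sumK : \sum_(1 <= l < d.+1) (K l)%:R = n%:R - 1 :> R.
  rewrite (card_levels o) natr_sum big_ord_recl level0 // addrAC subrr add0r.
  by rewrite big_add1 big_mkord.
have kap0 : kap 0 = 1.
  rewrite /kap level0 // mul1n (inter_b0 conn reg inter o) divff // pnatr_eq0.
  by rewrite -lt0n -(inter_b0 conn reg inter o) (inter_b_gt0 conn inter d_gt0).
have [||||||||| e [f [e_bd f0 f_bd f_step]]] := @radial_profile R d (fun i => (K i)%:R) kap _ _
    (d%:R * (n%:R * ratio)) _ tail_resistance_le (n%:R - 1) delta => //.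
- by move=> i; rewrite divr_ge0 ?ler0n.
- by rewrite mulr_ge0 ?ler0n // mulr_ge0 ?ler0n.
- lra.
- rewrite /delta.
  have -> : 2 * d%:R * (d%:R * (n%:R * ratio)) = 2 * n%:R * (d%:R ^+ 2 * ratio) by ring.
  have -> : 4 * d%:R ^+ 2 * ratio * (n%:R - 1) = 4 * (n%:R - 1) * (d%:R ^+ 2 * ratio) by ring.
  have d2_ge0 : 0 <= d%:R ^+ 2 * ratio by rewrite mulr_ge0 // exprn_ge0.
  by rewrite ler_wpM2r //; lra.
exists e, f; split=> //.
  have := f_step 0%N d_gt0; rewrite f0 subr0 kap0 mulr1 => ->; congr (_ * _).
  rewrite (sum_level) big_ord_recl f0 mul0rn add0r big_add1 big_mkord.
  by apply: eq_bigr => i _; rewrite mulr_natl.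
move=> v vo; have := gdist_eq0 conn o v; rewrite (negbTE vo).
have := gdist_diameter o v; rewrite (@sum_neighbors _ _ _ _ conn inter d_gt0 o _ f v _ erefl).
move: (gdist o v) => i id; case: i id => // i id _ /=.
have flux j : (j <= d)%N -> (K j)%:R * (b j)%:R * (f j.+1 - f j) =
    k%:R * e * \sum_(j.+1 <= l < d.+1) (K l)%:R * f l.
  rewrite leq_eqVlt => /predU1P[->|jd].
    by rewrite (inter_b_diameter conn inter d_gt0) big_geq // !mulr0 mul0r.
  rewrite f_step // /kap -natrM; field.
  rewrite !pnatr_eq0 -!lt0n (inter_b_gt0 conn inter d_gt0) //.
  by rewrite (level_gt0 conn inter d_gt0) // ltnW.
(* The difference of the flux equations for two consecutive levels is the
   eigenvalue equation multiplied by the size of the level. *)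
have fl1 := flux _ id; have fl0 := flux _ (ltnW id).
rewrite big_ltn // -natrM (level_flux inter) natrM in fl0.
have -> : k = (c i.+1 + a i.+1 + b i.+1)%N by rewrite (inter_sum conn reg inter d_gt0).
have K_neq0 : (K i.+1)%:R != 0 :> R.
  by rewrite pnatr_eq0 -lt0n (level_gt0 conn inter d_gt0).
apply: (mulfI K_neq0).
rewrite -(mulr_natl (f i)) -(mulr_natl (f i.+1)) -(mulr_natl (f i.+2)) !natrD.
have kE : k%:R = (c i.+1)%:R + (a i.+1)%:R + (b i.+1)%:R :> R.
  by rewrite -(inter_sum conn reg inter d_gt0 id) !natrD.
rewrite kE in fl0 fl1.
by move: fl0 fl1; set s := \sum_(_ <= _ < _) _ => fl0 fl1; lra.
Qed.

End DirichletProfile.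

(** * Orthogonality of eigenspaces and perturbation *)

Section EigenProjections.
Variables (R : realType) (n : nat).
Local Notation C := R[i].
Local Open Scope sesquilinear_scope.
Implicit Types (U : 'M[C]_n) (x y : 'cV[C]_n).

Definition energy x : R := \sum_j Normc.normc (x j ord0) ^+ 2.

Lemma normcE (z : C) : (Normc.normc z)%:C%C = `|z|.
Proof. by case: z. Qed.

Lemma normc_ge0 (z : C) : 0 <= Normc.normc z.
Proof. by case: z => ? ?; exact: sqrtr_ge0. Qed.

Lemma energyE x : (energy x)%:C%C = dotmx x^T x^T.
Proof.
rewrite dotmxE mxE rmorph_sum; apply: eq_bigr => j _.
by rewrite !mxE rmorphXn /= normcE normCK.
Qed.

Lemma energy_ge0 x : 0 <= energy x.
Proof. by apply: sumr_ge0 => j _; rewrite exprn_ge0 // normc_ge0. Qed.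

Lemma eigenvalue_tr U l : eigenvalue U^T l = eigenvalue U l.
Proof.
rewrite !eigenvalue_root_char /char_poly -det_tr; congr (root (\det _) l).
by apply/matrixP=> i j; rewrite !mxE eq_sym.
Qed.

Lemma finite_eigenvalues U : finite_set [set l | eigenvalue U l].
Proof.
have [r rE] := closed_field_poly_normal (char_poly U).
apply: (@sub_finite_set _ _ [set` r]); last exact: finite_seq.
move=> l /=; rewrite eigenvalue_root_char {1}rE.
rewrite (monicP (char_poly_monic U)) (scale1r (\prod_(z <- r) _)).
by rewrite root_prod_XsubC.
Qed.

Section Unitary.
Variable U : 'M[C]_n.
Hypothesis unitU : U^T \is unitarymx.

Lemma mulmx_unit_dot m p (A : 'M[C]_(m, n)) (B : 'M[C]_(p, n)) :
  (A *m U^T) *m (B *m U^T)^t* = A *m B^t*.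
Proof. by rewrite trmx_mul map_mxM mulmxA -(mulmxA A) (unitarymxP unitU) mulmx1. Qed.

Lemma eigenvector_unit (v : 'rV[C]_n) (l : C) : v != 0 -> v *m U^T = l *: v -> l * l^* = 1.
Proof.
move=> v0 vl; have dv0 : dotmx v v != 0 by rewrite gt_eqF // dotmx_is_dotmx.
apply: (mulIf dv0); rewrite mul1r !dotmxE -[in RHS]mulmx_unit_dot vl.
by rewrite linearZ /= map_mxZ -scalemxAl -scalemxAr !mxE mulrA.
Qed.

Lemma eigenspace_ortho (l m : C) : l != m ->
  eigenspace U^T l *m (eigenspace U^T m)^t* = 0.
Proof.
move=> lm.
have : eigenspace U^T m *m U^T = m *: eigenspace U^T m by apply/eigenspaceP.
have : eigenspace U^T l *m U^T = l *: eigenspace U^T l by apply/eigenspaceP.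
move: (eigenspace U^T l) (eigenspace U^T m) => A B Al Bm.
have [->|B0] := eqVneq B 0; first by rewrite trmx0 map_mx0 mulmx0.
have mm : m * m^* = 1.
  have /rowV0Pn[v /submxP[D vE] v0] := B0.
  by apply: (eigenvector_unit v0); rewrite vE -mulmxA Bm scalemxAr.
have trZ : (m *: B)^t* = m^* *: B^t* by apply/matrixP=> i j; rewrite !mxE rmorphM.
have := mulmx_unit_dot A B; rewrite Al Bm trZ -scalemxAl -scalemxAr scalerA.
move=> /eqP; rewrite -subr_eq0 -[X in _ - X]scale1r -scalerBl scaler_eq0.
case/orP=> [|/eqP //]; rewrite subr_eq0 -mm => /eqP lE.
case/eqP: lm; apply: (mulIf _ lE).
by apply: contra_eq_neq mm => ->; rewrite mulr0 eq_sym oner_eq0.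
Qed.

Lemma eigenprojection_id l y : U *m y = l *: y -> eigenprojection U l *m y = y.
Proof.
move=> Uy; apply: (can_inj trmxK); rewrite trmx_mul trmxK proj_ortho_id //.
by apply/eigenspaceP; rewrite -trmx_mul Uy linearZ.
Qed.

Lemma eigenprojection_0 l m y : l != m -> U *m y = l *: y ->
  eigenprojection U m *m y = 0.
Proof.
move=> lm Uy; apply: (can_inj trmxK); rewrite trmx_mul trmxK trmx0 proj_ortho_0 //.
apply: submx_trans (_ : _ <= eigenspace U^T l)%MS _.
  by apply/eigenspaceP; rewrite -trmx_mul Uy linearZ.
by apply/orthomx1P; rewrite eigenspace_ortho.
Qed.

Lemma dotmx_sub0 p (W : 'M[C]_(p, n)) (u w : 'rV[C]_n) :
  u *m W^t* = 0 -> (w <= W)%MS -> dotmx u w = 0.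
Proof. by move=> uW /submxP[D ->]; rewrite dotmxE trmx_mul map_mxM mulmxA uW mul0mx mxE. Qed.

Lemma dotmxC (u w : 'rV[C]_n) : dotmx u w = (dotmx w u)^*.
Proof.
rewrite !dotmxE !mxE rmorph_sum; apply: eq_bigr => j _.
by rewrite !mxE rmorphM mulrC; congr (_ * _); exact/esym/conjCK.
Qed.

Lemma dotmxB (u w : 'rV[C]_n) :
  dotmx (u - w) (u - w) = dotmx u u - dotmx u w - (dotmx w u - dotmx w w).
Proof.
have subE (A B : 'M[C]_1) : (A - B) 0 0 = A 0 0 - B 0 0 by rewrite !mxE.
rewrite !dotmxE linearB /= map_mxB mulmxBl !mulmxBr.
by rewrite !subE.
Qed.

(** Bessel's inequality, the eigenspaces being mutually orthogonal. *)
Lemma sum_energy_eigenprojection (s : seq C) x : uniq s ->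
  \sum_(l <- s) energy (eigenprojection U l *m x) <= energy x.
Proof.
move=> s_uniq; rewrite -lecR rmorph_sum /=.
under eq_bigr do rewrite energyE trmx_mul trmxK.
rewrite energyE; set v := x^T; pose p l := v *m proj_ortho (eigenspace U^T l).
have dotp l m : dotmx (p l) (p m) = if l == m then dotmx v (p l) else 0.
  case: eqVneq => [<-|lm].
    apply/esym/eqP; rewrite -subr_eq0 -linearBl; apply/eqP.
    apply: dotmx_sub0 (proj_ortho_sub _ _); apply/orthomx1P.
    exact: proj_ortho_compl_sub.
  apply: dotmx_sub0 (proj_ortho_sub _ _); apply/orthomx1P.
  apply: submx_trans (proj_ortho_sub _ _) _.
  by apply/orthomx1P; rewrite eigenspace_ortho.
pose y := \sum_(l <- s) p l.
have dot_vy : dotmx v y = \sum_(l <- s) dotmx (p l) (p l).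
  by rewrite /y linear_sumr; apply: eq_bigr => l _; rewrite dotp eqxx.
have dot_yy : dotmx y y = dotmx v y.
  rewrite dot_vy /y linear_sumr; apply: eq_big_seq => l ls.
  rewrite -[LHS]/(dotmx _ _) dotmxC linear_sumr /= (bigD1_seq l) //=.
  rewrite big1 ?addr0 -?dotmxC // => m ml.
  by rewrite dotp eq_sym (negbTE ml).
have dot_yv : dotmx y v = dotmx v y.
  rewrite dotmxC -dot_yy; apply: conj_Creal; apply: ger0_real; exact: dnorm_ge0.
rewrite -/p -dot_vy -subr_ge0.
clearbody y.
suff -> : dotmx v v - dotmx v y = dotmx (v - y) (v - y) by exact: dnorm_ge0.
move: dot_yy dot_yv (dotmxB v y).
move: (dotmx y y) (dotmx y v) (dotmx v y) (dotmx v v) (dotmx (v - y) (v - y)).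
by move=> ? ? B A ? -> -> ->; rewrite subrr subr0.
Qed.

(** The cross term 2 |p| |q| is at most t |p|^2 + |q|^2 / t. *)
Lemma sqr_normc_perturb (t : R) (p q : C) : 0 < t ->
  `|Normc.normc (p + q) ^+ 2 - Normc.normc p ^+ 2| <=
  t * Normc.normc p ^+ 2 + (1 + t^-1) * Normc.normc q ^+ 2.
Proof.
move=> t_gt0; have h1 := le_normcD p q; have := le_normcD (p + q) (- q).
have := normc_ge0 (p + q); have := normc_ge0 p; have := normc_ge0 q.
rewrite addrK normcN; move: (Normc.normc _) (Normc.normc p) (Normc.normc q) h1.
move=> N A B h1 B0 A0 N0 h2.
have AB : 2 * A * B <= t * A ^+ 2 + t^-1 * B ^+ 2.
  have : 0 <= t * (A - t^-1 * B) ^+ 2 by rewrite mulr_ge0 ?sqr_ge0 // ltW.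
  have -> : t * (A - t^-1 * B) ^+ 2 = t * A ^+ 2 + t^-1 * B ^+ 2 - 2 * A * B.
    by field; rewrite gt_eqF.
  by rewrite subr_ge0.
by rewrite ler_norml; apply/andP; split; nra.
Qed.

(** The projections of y1 + y2 are y1 for the eigenvalue z1, y2 for z2, and 0
    for every other eigenvalue; the contribution of r is controlled by Bessel's
    inequality.  The free parameter t trades the two error terms off. *)
Lemma eigenprojection_perturb (S : pred 'I_n) (z1 z2 : C) (y1 y2 r x : 'cV[C]_n) (t : R)
    (Q := \sum_(j | S j) (Normc.normc (y1 j ord0) ^+ 2 + Normc.normc (y2 j ord0) ^+ 2)) :
    z1 != z2 -> y1 != 0 -> y2 != 0 -> U *m y1 = z1 *: y1 -> U *m y2 = z2 *: y2 ->
    x = y1 + y2 + r -> 0 < t ->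
  `|\sum_(j | S j) \sum_(l \in [set l | eigenvalue U l])
      Normc.normc ((eigenprojection U l *m x) j ord0) ^+ 2 - Q|
  <= t * Q + (1 + t^-1) * energy r.
Proof.
move=> z12 y1_neq0 y2_neq0 Uy1 Uy2 xE t_gt0.
have fin := finite_eigenvalues U.
pose s : seq C := finmap.enum_fset (fset_set [set l | eigenvalue U l]).
have s_uniq : uniq s by exact: finmap.fset_uniq.
have in_s z y : y != 0 -> U *m y = z *: y -> z \in s.
  move=> y_neq0 Uy; rewrite in_fset_set // inE /= -eigenvalue_tr.
  apply/eigenvalueP; exists y^T; first by rewrite -trmx_mul Uy linearZ.
  by apply: contra_neq y_neq0 => y0; rewrite -[y]trmxK y0 trmx0.
pose w l := if l == z1 then y1 else if l == z2 then y2 else 0.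
have PE l : eigenprojection U l *m x = w l + eigenprojection U l *m r.
  rewrite xE !mulmxDr; congr (_ + _); rewrite /w.
  have [->|lz1] := eqVneq l z1.
    by rewrite (eigenprojection_id Uy1) (eigenprojection_0 _ Uy2) ?addr0 // eq_sym.
  rewrite (eigenprojection_0 _ Uy1) 1?eq_sym // add0r.
  have [->|lz2] := eqVneq l z2; first by rewrite (eigenprojection_id Uy2).
  by rewrite (eigenprojection_0 _ Uy2) // eq_sym.
have wE j : Normc.normc (y1 j ord0) ^+ 2 + Normc.normc (y2 j ord0) ^+ 2 =
    \sum_(l <- s) Normc.normc (w l j ord0) ^+ 2.
  rewrite (bigD1_seq z1) ?(in_s _ _ y1_neq0) //= /w eqxx; congr (_ + _).
  rewrite big_mkcond (bigD1_seq z2) ?(in_s _ _ y2_neq0) //= eqxx.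
  rewrite eq_sym (negbTE z12) /= big1 ?addr0 // => l lz2.
  by case: (l == z1) => //=; rewrite (negbTE lz2) mxE Normc.normc0 expr0n.
have QE : Q = \sum_(j | S j) \sum_(l <- s) Normc.normc (w l j ord0) ^+ 2.
  by apply: eq_bigr => j _; rewrite wE.
rewrite (eq_bigr (fun j => \sum_(l <- s)
    Normc.normc (w l j ord0 + (eigenprojection U l *m r) j ord0) ^+ 2)); last first.
  by move=> j _; rewrite fsbig_finite //; apply: eq_bigr => l _; rewrite PE mxE.
have : \sum_(j | S j) \sum_(l <- s)
    Normc.normc ((eigenprojection U l *m r) j ord0) ^+ 2 <= energy r.
  apply: le_trans (sum_energy_eigenprojection r s_uniq); rewrite exchange_big /=.
  apply: ler_sum => l _; rewrite /energy [leRHS](bigID S) /= lerDl.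
  by apply: sumr_ge0 => j _; rewrite exprn_ge0 // normc_ge0.
have t1_ge0 : 0 <= 1 + t^-1 by rewrite addr_ge0 // invr_ge0 ltW.
move/(ler_wpM2l t1_ge0); rewrite -(lerD2l (t * Q)); apply: le_trans.
rewrite QE -sumrB !mulr_sumr -big_split /=.
apply: le_trans (ler_norm_sum _ _ _) _; apply: ler_sum => j _.
rewrite -sumrB !mulr_sumr -big_split /=.
apply: le_trans (ler_norm_sum _ _ _) _; apply: ler_sum => l _.
exact: sqr_normc_perturb.
Qed.

End Unitary.
End EigenProjections.

(** * The quantum walk on arc functions *)

Section Walk.
Variables (R : realType) (G : sgraph) (k : nat) (o : G).
Hypothesis reg : regular G k.
Hypothesis k_gt0 : (0 < k)%N.
Local Notation C := R[i].
Local Notation N := #|darc G|.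
Local Notation arc_of := (@enum_val (darc G) predT).
Local Open Scope sesquilinear_scope.

Definition darc_rev (x : darc G) : darc G :=
  exist (fun p : G * G => adj p.1 p.2) (Defs.head x, tail x) (etrans (adj_sym _ _) (svalP x)).

Lemma darc_revK : involutive darc_rev.
Proof. by case=> [[u v] uv]; apply: val_inj. Qed.

Lemma darc_eqE (x y : darc G) : (x == y) = (tail x == tail y) && (Defs.head x == Defs.head y).
Proof. by rewrite -val_eqE; case: x y => [[u v] uv] [[u' v'] uv']. Qed.

Lemma sum_darc (V : nmodType) (P : pred G) (F : G -> G -> V) :
  \sum_(x : darc G | P (tail x)) F (tail x) (Defs.head x) =
  \sum_(u | P u) \sum_(v | adj u v) F u v.
Proof.
rewrite pair_big_dep /=.
rewrite (eq_bigl (fun p : G * G => (p \in [pred p : G * G | adj p.1 p.2]) && P p.1)).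
  by rewrite (big_sub_cond _ (fun p : G * G => P p.1) (fun p : G * G => F p.1 p.2)).
by move=> p; rewrite inE /= andbC.
Qed.

Lemma sum_darc_tail (V : nmodType) (u : G) (F : G -> V) :
  \sum_(x : darc G | tail x == u) F (Defs.head x) = \sum_(v | adj u v) F v.
Proof. by rewrite (sum_darc (fun v => v == u) (fun _ v => F v)) big_pred1_eq. Qed.

Lemma sum_arc_index (V : nmodType) (P : pred (darc G)) (F : darc G -> V) :
  \sum_(j < N | P (arc_of j)) F (arc_of j) = \sum_(x : darc G | P x) F x.
Proof.
rewrite big_mkcond [RHS]big_mkcond.
by rewrite -(@big_enum_val _ _ _ _ predT (fun x => if P x then F x else 0)).
Qed.

Lemma degree_sum (V : nmodType) (u : G) (z : V) : \sum_(v | adj u v) z = z *+ k.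
Proof. by rewrite sumr_const -(reg u) cardsE. Qed.

Definition arcvec (g : darc G -> C) : 'cV[C]_N := \col_j g (arc_of j).

Lemma arcvecE (v : 'cV[C]_N) : v = arcvec (fun x => v (enum_rank x) ord0).
Proof. by apply/colP=> j; rewrite mxE enum_valK. Qed.

Lemma eq_arcvec g h : g =1 h -> arcvec g = arcvec h.
Proof. by move=> gh; apply/colP=> j; rewrite !mxE gh. Qed.

Lemma arc_reversal_act g : arc_reversal R G *m arcvec g = arcvec (g \o darc_rev).
Proof.
apply/colP=> j; rewrite !mxE.
under eq_bigr do rewrite !mxE.
rewrite (sum_arc_index predT (fun y => ((tail (arc_of j) == Defs.head y) &&
  (Defs.head (arc_of j) == tail y))%:R * g y)).
rewrite (bigD1 (darc_rev (arc_of j))) //= !eqxx mul1r big1 ?addr0 // => y.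
rewrite darc_eqE /= andbC ![_ == tail (arc_of j)]eq_sym eq_sym => /negbTE.
by rewrite [tail y == _]eq_sym => ->; rewrite mul0r.
Qed.

Lemma oracle_act g : oracle R o *m arcvec g =
  arcvec (fun x => if tail x == o then - g x else g x).
Proof.
apply/colP=> j; rewrite !mxE.
rewrite (bigD1 j) //= !mxE eqxx big1 ?addr0 => [|l lj].
  by case: ifP; rewrite ?mulN1r ?mul1r.
by rewrite !mxE eq_sym (negbTE lj) mul0r.
Qed.

Lemma coin_act g : coin R G k *m arcvec g =
  arcvec (fun x => 2 / k%:R * (\sum_(y : darc G | tail y == tail x) g y) - g x).
Proof.
apply/colP=> j; rewrite !mxE.
under eq_bigr do rewrite !mxE.
rewrite (eq_bigr (fun l =>
    (if tail (arc_of l) == tail (arc_of j) then 2 / k%:R * g (arc_of l) else 0)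
    - (if l == j then g (arc_of j) else 0))); last first.
  move=> l _; rewrite (eq_sym (tail (arc_of l))) (eq_sym l).
  case: (eqVneq j l) => [<-|jl]; first by rewrite eqxx mulrBl mul1r.
  by rewrite subr0; case: ifP; rewrite ?mul0r // subr0.
rewrite sumrB -!big_mkcond big_pred1_eq -mulr_sumr.
by rewrite (sum_arc_index (fun y => tail y == tail (arc_of j)) g).
Qed.

Let k_neq0 : k%:R != 0 :> C.
Proof. by rewrite pnatr_eq0 -lt0n. Qed.

Lemma arc_count (u : G) (z : C) : \sum_(y : darc G | tail y == u) z = k%:R * z.
Proof. by rewrite (sum_darc_tail u (fun=> z)) degree_sum mulr_natl. Qed.

Lemma act_involutive (A : 'M[C]_N) (f : (darc G -> C) -> (darc G -> C)) :
  (forall g, A *m arcvec g = arcvec (f g)) -> (forall g, f (f g) =1 g) -> A *m A = 1%:M.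
Proof.
move=> Af ff; apply/matrixP=> i j.
have : A *m A *m col j 1%:M = col j 1%:M.
  by rewrite [X in _ *m X]arcvecE -mulmxA !Af [RHS]arcvecE; apply: eq_arcvec.
by rewrite !colE mulmxA mulmx1 -!colE => /colP/(_ i); rewrite !mxE.
Qed.

Lemma arc_reversal_sq : arc_reversal R G *m arc_reversal R G = 1%:M.
Proof. by apply: (act_involutive arc_reversal_act) => g x /=; rewrite darc_revK. Qed.

Lemma oracle_sq : oracle R o *m oracle R o = 1%:M.
Proof. by apply: (act_involutive oracle_act) => g x /=; case: (tail x == o); rewrite ?opprK. Qed.

Lemma coin_sq : coin R G k *m coin R G k = 1%:M.
Proof.
apply: (act_involutive coin_act) => g x; set s := \sum_(_ | _) g _.
have -> : \sum_(y : darc G | tail y == tail x)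
    (2 / k%:R * (\sum_(z : darc G | tail z == tail y) g z) - g y) = s.
  rewrite sumrB (eq_bigr (fun=> 2 / k%:R * s)) => [|y /eqP -> //].
  by rewrite arc_count -/s; field.
by ring.
Qed.

(** The three factors of the transition matrix are real symmetric
    involutions. *)
Lemma transition_unitary : (transition R k o)^T \is unitarymx.
Proof.
have rev_tr : (arc_reversal R G)^T = arc_reversal R G.
  by apply/matrixP=> i j; rewrite !mxE andbC ![_ == _ (arc_of i)]eq_sym.
have coin_tr : (coin R G k)^T = coin R G k.
  by apply/matrixP=> i j; rewrite !mxE eq_sym [j == i]eq_sym.
have oracle_tr : (oracle R o)^T = oracle R o.
  by apply/matrixP=> i j; rewrite !mxE eq_sym; case: eqVneq => // ->.
have rev_cj : map_mx Num.conj (arc_reversal R G) = arc_reversal R G.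
  by apply/matrixP=> i j; rewrite !mxE rmorph_nat.
have coin_cj : map_mx Num.conj (coin R G k) = coin R G k.
  apply/matrixP=> i j; rewrite !mxE; case: ifP; rewrite ?rmorph0 // => _.
  by rewrite rmorphB rmorphM fmorphV /= !rmorph_nat.
have oracle_cj : map_mx Num.conj (oracle R o) = oracle R o.
  apply/matrixP=> i j; rewrite !mxE; case: ifP; rewrite ?rmorph0 // => _.
  by case: ifP; rewrite ?rmorphN rmorph1.
apply/unitarymxP; rewrite trmxK /transition !trmx_mul rev_tr coin_tr oracle_tr.
rewrite !map_mxM rev_cj coin_cj oracle_cj.
rewrite -!mulmxA (mulmxA (arc_reversal R G)) arc_reversal_sq mul1mx.
by rewrite (mulmxA (coin R G k)) coin_sq mul1mx oracle_sq.
Qed.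

(** * The invariant plane of a radial eigenfunction *)

(** For z = mu + i s and its conjugate z' the difference is 2 i s, whence the
    modulus of the coefficient b. *)
Lemma unit_circle_pair (mu c : R) : -1 < mu < 1 ->
  exists z z' b : C, [/\ z * z' = 1, z + z' = (2 * mu)%:C%C, z != z',
    c%:C%C = b * (z - z') & Normc.normc b ^+ 2 = c ^+ 2 / (4 * (1 - mu ^+ 2))].
Proof.
move=> mu_bd; have s2_gt0 : 0 < 1 - mu ^+ 2 by case/andP: mu_bd => ? ?; nra.
pose s := Num.sqrt (1 - mu ^+ 2); have s_gt0 : 0 < s by rewrite sqrtr_gt0.
have s2 : s ^+ 2 = 1 - mu ^+ 2 by rewrite sqr_sqrtr // ltW.
have zBz' : (mu +i* s)%C - (mu -i* s)%C = (0 +i* (2 * s))%C.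
  by simpc; congr (_ +i* _)%C; ring.
have zBz'_neq0 : (mu +i* s)%C - (mu -i* s)%C != 0 :> C.
  by rewrite zBz' eq_complex /= eqxx /= mulf_neq0 ?gt_eqF ?pnatr_eq0.
exists (mu +i* s)%C, (mu -i* s)%C, (c%:C%C / ((mu +i* s)%C - (mu -i* s)%C)); split.
- by simpc; congr (_ +i* _)%C; [rewrite -!expr2 s2|]; ring.
- by simpc; congr (_ +i* _)%C; ring.
- by rewrite -subr_eq0.
- by rewrite divfK.
have nc : Normc.normc c%:C%C = `|c| by rewrite /= expr0n addr0 sqrtr_sqr.
have ns : Normc.normc (0 +i* (2 * s))%C = 2 * s.
  by rewrite /= expr0n add0r sqrtr_sqr gtr0_norm // mulr_gt0.
rewrite Normc.normcM Normc.normcV zBz' nc ns exprMn real_normK ?num_real // -s2.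
by field; rewrite gt_eqF.
Qed.

Section Eigenvectors.
Variables (F : G -> R) (f1 mu : R).
Hypothesis F_o : F o = 0.
Hypothesis F_nb : forall v, adj o v -> F v = f1.
Hypothesis F_eq : forall v, v != o -> \sum_(w | adj v w) F w = k%:R * mu * F v.

Let Tl := arcvec (fun x => (F (tail x))%:C%C).
Let Hd := arcvec (fun x => (F (Defs.head x))%:C%C).

(** The oracle fixes Tl because F vanishes at o, and the coin fixes it because
    Tl depends on the tail alone; only the reversal acts. *)
Lemma transition_tail : transition R k o *m Tl = Hd.
Proof.
rewrite /transition -!mulmxA oracle_act coin_act arc_reversal_act; apply: eq_arcvec => x /=.
set u := tail (darc_rev x); have uE : u = Defs.head x by [].
rewrite (eq_bigr (fun=> (F u)%:C%C)) => [|y /eqP yu]; last first.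
  by rewrite yu -/u; case: eqP => // ->; rewrite F_o oppr0.
rewrite arc_count -uE.
have -> : (if u == o then - (F u)%:C%C else (F u)%:C%C) = (F u)%:C%C.
  by case: eqP => // ->; rewrite F_o oppr0.
by field.
Qed.

(** Away from o the eigenvalue equation gives the average that the coin takes.
    At o the oracle turns F into - F, and the coin reflects it in its mean - f1,
    which leaves it equal to its mean because F is constant on the neighbours
    of o; this agrees with 2 mu Tl - Hd there because F vanishes at o. *)
Lemma transition_head : transition R k o *m Hd = (2 * mu)%:C%C *: Hd - Tl.
Proof.
rewrite /transition -!mulmxA oracle_act coin_act arc_reversal_act.
apply/colP=> j; rewrite !mxE; move: (arc_of j) => x /=.
set u := tail (darc_rev x); have uE : u = Defs.head x by [].
have -> : Defs.head (darc_rev x) = tail x by [].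
rewrite -uE; case: eqP => [uo|/eqP uo].
  rewrite (eq_bigr (fun y : darc G => (- F (Defs.head y))%:C%C)); last first.
    by move=> y /eqP ->; rewrite uo eqxx rmorphN.
  rewrite (sum_darc_tail u (fun v => (- F v)%:C%C)) uo.
  rewrite (eq_bigr (fun=> (- f1)%:C%C)) => [|v ov]; last by rewrite F_nb.
  rewrite degree_sum -mulr_natl F_o.
  have ox : adj o (tail x) by rewrite -uo; exact: (svalP (darc_rev x)).
  by rewrite (F_nb ox) rmorphN rmorph0; field.
rewrite (eq_bigr (fun y : darc G => (F (Defs.head y))%:C%C)); last first.
  by move=> y /eqP ->; rewrite (negbTE uo).
rewrite (sum_darc_tail u (fun v => (F v)%:C%C)) -rmorph_sum F_eq //.
by rewrite !rmorphM !rmorph_nat; field.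
Qed.

Hypothesis mu_bd : -1 < mu < 1.
Hypothesis f1_neq0 : f1 != 0.
Let c : R := (Num.sqrt ((#|G| * k)%N%:R : R))^-1.

Variable delta : R.
Hypothesis F_flat : forall v, v != o -> (1 - F v) ^+ 2 <= delta ^+ 2.

(** The tails at o contribute 1 / n, the others together at
    most delta^2. *)
Lemma energy_defect :
  energy (initial_state R G k - c%:C%C *: Tl) <= (#|G|%:R)^-1 + delta ^+ 2.
Proof.
have n_gt0 : 0 < #|G|%:R :> R by rewrite ltr0n; apply/card_gt0P; exists o.
have kR_gt0 : 0 < k%:R :> R by rewrite ltr0n.
have c2 : c ^+ 2 = (#|G|%:R * k%:R)^-1.
  by rewrite /c exprVn sqr_sqrtr ?ler0n // natrM.
have -> : energy (initial_state R G k - c%:C%C *: Tl) =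
    \sum_(u : G) (#|G|%:R)^-1 * (1 - F u) ^+ 2.
  rewrite /energy (eq_bigr (fun j : 'I_N => c ^+ 2 * (1 - F (tail (arc_of j))) ^+ 2)).
    rewrite (sum_arc_index predT (fun x => c ^+ 2 * (1 - F (tail x)) ^+ 2)).
    rewrite (sum_darc predT (fun u _ => c ^+ 2 * (1 - F u) ^+ 2)).
    apply: eq_bigr => u _; rewrite degree_sum -mulr_natl c2.
    by field; rewrite !gt_eqF.
  move=> j _; rewrite !mxE -/c -rmorphM -rmorphB /= /Normc.normc.
  by rewrite expr0n addr0 sqr_sqrtr ?sqr_ge0 // -exprMn; congr (_ ^+ 2); ring.
rewrite -mulr_sumr (bigD1 o) //= F_o subr0 expr1n mulrDr mulr1 lerD2l.
rewrite mulrC ler_pdivrMr //.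
apply: (@le_trans _ _ (\sum_(v | v != o) delta ^+ 2)); first exact: ler_sum.
rewrite sumr_const -[X in X <= _]mulr_natr ler_wpM2l ?sqr_ge0 // ler_nat; exact: max_card.
Qed.

(** On an arc leaving o the eigenvectors Hd - z' Tl and Hd - z Tl both take the
    value f1, since Tl vanishes there; weighted by the coefficients +- b of Tl,
    the k arcs and two eigenvalues together contribute Q. *)
Lemma search_prob_estimate (t : R) (Q := f1 ^+ 2 / (2 * #|G|%:R * (1 - mu ^+ 2))) :
  0 < t ->
  `|avg_search_prob R k o - Q| <= t * Q + (1 + t^-1) * ((#|G|%:R)^-1 + delta ^+ 2).
Proof.
move=> t_gt0.
have n_gt0 : 0 < #|G|%:R :> R by rewrite ltr0n; apply/card_gt0P; exists o.
have kR_gt0 : 0 < k%:R :> R by rewrite ltr0n.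
have c2 : c ^+ 2 = (#|G|%:R * k%:R)^-1.
  by rewrite /c exprVn sqr_sqrtr ?ler0n // natrM.
have s2_gt0 : 0 < 1 - mu ^+ 2 by case/andP: mu_bd => ? ?; nra.
have c_gt0 : 0 < c.
  rewrite invr_gt0 sqrtr_gt0 ltr0n muln_gt0 k_gt0 andbT.
  by apply/card_gt0P; exists o.
have [z [z' [b [zz' zDz' z12 cE nb]]]] := unit_circle_pair c mu_bd.
have b_neq0 : b != 0.
  apply/eqP => b0; move/eqP: cE; rewrite b0 mul0r eq_complex /= eqxx andbT.
  by rewrite gt_eqF.
have [x0 [x0t x0h]] : exists x0 : darc G, tail x0 = o /\ F (Defs.head x0) = f1.
  have : (0 < #|[set w | adj o w]%SET|)%N by rewrite reg.
  case/card_gt0P=> w; rewrite inE => ow.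
  by exists (exist (fun p : G * G => adj p.1 p.2) (o, w) ow); rewrite /tail /= F_nb.
pose y1 := b *: (Hd - z' *: Tl); pose y2 := - b *: (Hd - z *: Tl).
have nz (b' w : C) : b' != 0 -> b' *: (Hd - w *: Tl) != 0.
  move=> b'0; rewrite scaler_eq0 negb_or b'0 /=; apply/eqP => /colP/(_ (enum_rank x0)).
  rewrite !mxE enum_rankK x0t x0h F_o rmorph0 mulr0 subr0.
  by move/eqP; rewrite eq_complex /= (negbTE f1_neq0).
have eig (b' w w' : C) : w * w' = 1 -> w + w' = (2 * mu)%:C%C ->
    transition R k o *m (b' *: (Hd - w' *: Tl)) = w *: (b' *: (Hd - w' *: Tl)).
  move=> ww' wDw'; rewrite -scalemxAr mulmxBr -scalemxAr transition_tail transition_head.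
  rewrite -wDw' scalerA [w * b']mulrC -scalerA; congr (_ *: _).
  rewrite scalerBr scalerA ww' scale1r scalerDl.
  by rewrite addrAC addrK.
have y1_neq0 : y1 != 0 by exact: nz.
have y2_neq0 : y2 != 0 by apply: nz; rewrite oppr_eq0.
have Uy1 : transition R k o *m y1 = z *: y1 by exact: eig.
have Uy2 : transition R k o *m y2 = z' *: y2.
  by apply: eig; [rewrite mulrC|rewrite addrC].
have xE : initial_state R G k = y1 + y2 + (initial_state R G k - c%:C%C *: Tl).
  suff <- : c%:C%C *: Tl = y1 + y2 by rewrite addrC subrK.
  rewrite cE /y1 /y2 scaleNr -scalerBr -scalerA; congr (_ *: _).
  by rewrite scalerBl opprB [RHS]addrC addrA subrK.
have := eigenprojection_perturb transition_unitary
  (fun j => tail (arc_of j) == o) z12 y1_neq0 y2_neq0 Uy1 Uy2 xE t_gt0.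
have -> : \sum_(j | tail (arc_of j) == o) (Normc.normc (y1 j ord0) ^+ 2 +
    Normc.normc (y2 j ord0) ^+ 2) = Q.
  pose wt : R := 2 * (c ^+ 2 / (4 * (1 - mu ^+ 2))).
  rewrite (eq_bigr (fun j => wt * F (Defs.head (arc_of j)) ^+ 2)).
    rewrite (sum_arc_index (fun x => tail x == o) (fun x => wt * F (Defs.head x) ^+ 2)).
    rewrite (sum_darc_tail o (fun v => wt * F v ^+ 2)).
    rewrite (eq_bigr (fun=> wt * f1 ^+ 2)) => [|v ov]; last by rewrite F_nb.
    rewrite degree_sum -mulr_natl /wt c2 /Q; field.
    by rewrite !gt_eqF.
  have entry (b' w : C) j : tail (arc_of j) = o ->
      (b' *: (Hd - w *: Tl)) j ord0 = b' * (F (Defs.head (arc_of j)))%:C%C.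
    by move=> jo; rewrite !mxE jo F_o rmorph0 mulr0 subr0.
  move=> j /eqP jo; rewrite /y1 /y2 !entry // !Normc.normcM normcN !exprMn nb.
  by rewrite /= expr0n addr0 sqr_sqrtr ?sqr_ge0 // /wt; ring.
move=> h; apply: le_trans h _; rewrite lerD2l ler_wpM2l //; last exact: energy_defect.
by rewrite addr_ge0 // invr_ge0 ltW.
Qed.

End Eigenvectors.
End Walk.

(** * The estimate for a single graph and the limit *)

(** The mass balance f1 = e S, with S between (1 - delta)(n - 1) and n - 1, turns
    Q into f1 S / (2 n (2 - e)); the numerator is close to n and e is small, so
    the quotient is close to 1 / 4. *)
Lemma main_term_bounds (R : realFieldType) (n e f1 S delta : R)
    (Q := f1 ^+ 2 / (2 * n * (1 - (1 - e) ^+ 2))) :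
    4 <= n -> 0 <= delta <= 1 / 4 -> 0 < e <= 2 / (n - 1) -> 1 - delta <= f1 <= 1 ->
    f1 = e * S -> (1 - delta) * (n - 1) <= S <= n - 1 ->
  `|Q - 1 / 4| <= 1 / 2 * (n^-1 + delta).
Proof.
move=> n4 /andP[de0 de1] /andP[e_gt0 e_le] /andP[f1_ge f1_le] f1E /andP[S_ge S_le].
have n_gt0 : 0 < n by lra.
have eM : e * (n - 1) <= 2 by rewrite -ler_pdivlMr //; lra.
have e_lt : e < 1 by nra.
have QE : Q = f1 * S / (2 * n * (2 - e)).
  by rewrite /Q expr2 {1}f1E; field; rewrite !gt_eqF //=; nra.
have D_gt0 : 0 < 2 * n * (2 - e) by nra.
have nV : n * n^-1 = 1 by rewrite divff ?gt_eqF.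
have nV_gt0 : 0 < n^-1 by rewrite invr_gt0.
rewrite ler_norml; apply/andP; split.
  rewrite lerBrDr QE ler_pdivlMr //.
  have h : (1 - delta) * ((1 - delta) * (n - 1)) <= f1 * S.
    by apply: ler_pM => //; nra.
  apply: le_trans h.
  have : (2 * n * (2 - e)) <= 4 * n by nra.
  nra.
rewrite lerBlDr QE ler_pdivrMr //.
have h : f1 * S <= n - 1 by nra.
apply: (le_trans h).
nra.
Qed.

Section Quarter.
Variables (R : realType) (G : sgraph) (k : nat) (c a b : nat -> nat).
Hypothesis conn : connected_graph G.
Hypothesis reg : regular G k.
Hypothesis inter : intersection_numbers G c a b.
Local Notation d := (diameter G).
Hypothesis d_gt0 : (0 < d)%N.
Variable o : G.
Local Notation n := (#|G|%:R : R).

Lemma valency_lt_card : (k < #|G|)%N.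
Proof.
rewrite -(reg o) -[in X in (_ < X)%N]cardsT; apply: proper_card.
by apply/properP; split; [exact: finset.subsetT|exists o; rewrite ?inE ?adj_irr].
Qed.

(** The error terms t Q and (1 + 1/t) s of the perturbation bound are balanced by
    t = sqrt s. *)
Lemma search_prob_near_quarter
    (delta := 4 * d%:R ^+ 2 *
       (k%:R ^+ (d - 1) / ((\prod_(2 <= i < d.+1) (c i)%:R) * n)))
    (s := n^-1 + delta) :
    4 <= n -> delta <= 1 / 4 ->
  `|avg_search_prob R k o - 1 / 4| <= 2 * (s + Num.sqrt s).
Proof.
move=> n4 de1.
have de0 : 0 <= delta.
  by rewrite mulr_ge0 ?divr_ge0 ?mulr_ge0 ?exprn_ge0 ?prodr_ge0 ?ler0n.
have n_gt1 : (1 < #|G|)%N by rewrite -(ltr_nat R); lra.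
have k_gt0 : (0 < k)%N.
  by rewrite -(inter_b0 conn reg inter o) (inter_b_gt0 conn inter d_gt0).
have de_lt : delta < 1 / 2 by lra.
have [e [f [e_bd f0 f_bd f1E f_eq]]] := dirichlet_profile conn reg inter d_gt0 o n_gt1 de_lt.
rewrite -/delta in f_bd.
pose F v := f (gdist o v).
have o0 : gdist o o = 0%N by apply/eqP; rewrite gdist_eq0.
have F_o : F o = 0 by rewrite /F o0.
have pos v : v != o -> (0 < gdist o v <= d)%N.
  by move=> vo; rewrite lt0n gdist_eq0 // vo gdist_diameter.
have F_nb v : adj o v -> F v = f 1%N.
  move=> ov; rewrite /F; have := gdist_adj conn o ov; rewrite o0.
  have /pos/andP[+ _] : v != o by apply: contraTneq ov => ->; rewrite adj_irr.
  by case: gdist => [|[]].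
have F_flat v : v != o -> (1 - F v) ^+ 2 <= delta ^+ 2.
  by move=> /pos/f_bd/andP[h1 h2]; rewrite -/(F v) in h1 h2; nra.
have [e_gt0 e_le] := andP e_bd.
have eM : e * (n - 1) <= 2 by rewrite -ler_pdivlMr //; lra.
have e_lt : e < 1 by nra.
have mu_bd : -1 < 1 - e < 1 by apply/andP; split; lra.
have f1_bd : 1 - delta <= f 1%N <= 1 by apply: f_bd.
have f1_neq0 : f 1%N != 0 by case/andP: f1_bd => ? ?; rewrite gt_eqF //; lra.
have count : \sum_(v : G | v != o) 1 = n - 1 :> R.
  by rewrite -[n]/(#|G|%:R) -sum1_card natr_sum [in RHS](bigD1 o) //= addrAC subrr add0r.
have S_bd : (1 - delta) * (n - 1) <= \sum_v F v <= n - 1.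
  rewrite (bigD1 o) //= F_o add0r -count mulr_sumr.
  by apply/andP; split; apply: ler_sum => v /pos/f_bd/andP[? ?]; rewrite ?mulr1.
have de_bd : 0 <= delta <= 1 / 4 by rewrite de0.
have := main_term_bounds n4 de_bd e_bd f1_bd f1E S_bd.
have nV_gt0 : 0 < n^-1 by rewrite invr_gt0; lra.
have nV_le : n^-1 <= 1 / 4 by rewrite div1r lef_pV2 ?posrE //; lra.
have s_gt0 : 0 < s by rewrite /s; lra.
have t_gt0 : 0 < Num.sqrt s by rewrite sqrtr_gt0.
have ts : Num.sqrt s ^+ 2 = s by rewrite sqr_sqrtr // ltW.
have := search_prob_estimate reg k_gt0 F_o F_nb f_eq mu_bd f1_neq0 F_flat t_gt0.
rewrite -/s; set Q := f 1%N ^+ 2 / _ => est Qbd.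
have rho : n^-1 + delta ^+ 2 <= s by rewrite /s; nra.
move: t_gt0 ts est; move: (Num.sqrt s) => t t_gt0 ts est.
have tV : t^-1 * s = t by rewrite -ts expr2 mulKf // gt_eqF.
have tV_gt0 : 0 < t^-1 by rewrite invr_gt0.
have h : (1 + t^-1) * (n^-1 + delta ^+ 2) <= s + t.
  have -> : s + t = (1 + t^-1) * s by rewrite mulrDl mul1r tV.
  by rewrite ler_wpM2l // addr_ge0 // ltW.
have Q_le : Q <= 1 / 2.
  by have := le_trans (ler_norm _) Qbd; rewrite /s in Qbd *; lra.
have -> : avg_search_prob R k o - 1 / 4 = (avg_search_prob R k o - Q) + (Q - 1 / 4) by ring.
apply: le_trans (ler_normD _ _) _; apply: le_trans (lerD est Qbd) _.
rewrite -/s; nra.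
Qed.

End Quarter.

Theorem theorem8p5 (R : realType) (d : nat) (hd : (3 <= d)%N)
  (T : set R) (T_pos : forall tau, T tau -> 0 < tau) (T_unbounded : ~ has_ubound T)
  (X : R -> sgraph) (k : R -> nat) (ai bi ci : R -> nat -> nat)
  (X_dr : forall tau, T tau -> distance_regular (X tau))
  (X_diam : forall tau, T tau -> diameter (X tau) = d)
  (X_reg : forall tau, T tau -> regular (X tau) (k tau))
  (X_inter : forall tau, T tau ->
     intersection_numbers (X tau) (ci tau) (ai tau) (bi tau))
  (k_incr : forall s t, T s -> T t -> s <= t -> (k s <= k t)%N)
  (k_infty : k tau @[tau --> within T +oo] --> \oo)
  (ratio_lim :
     (k tau)%:R ^+ (d - 1) /
       ((\prod_(2 <= i < d.+1) (ci tau i)%:R) * #|X tau|%:R)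
       @[tau --> within T +oo] --> (0 : R))
  (a : forall tau, X tau) :
  avg_search_prob R (k tau) (a tau) @[tau --> within T +oo] --> (1 / 4 : R).
Proof.
set ratio := fun tau => _ in ratio_lim.
pose s tau : R := harmonic (k tau) + 4 * d%:R ^+ 2 * ratio tau.
have k_harm : harmonic (k tau) @[tau --> within T +oo] --> (0 : R).
  apply: (cvg_comp _ _ k_infty); exact: cvg_harmonic.
have delta_lim : 4 * d%:R ^+ 2 * ratio tau @[tau --> within T +oo] --> (0 : R).
  by rewrite -[0 : R](mulr0 (4 * d%:R ^+ 2)); apply: cvgMr.
have s_lim : s tau @[tau --> within T +oo] --> (0 : R).
  by rewrite -[0 : R](addr0 0); apply: cvgD.
have bound_lim : 2 * (s tau + Num.sqrt (s tau)) @[tau --> within T +oo] --> (0 : R).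
  rewrite -[0 : R](mulr0 2) -[X in 2 * X](addr0 0) -{2}(sqrtr0 R).
  apply: cvgMr; apply: cvgD => //.
  by apply: (cvg_comp _ _ s_lim); exact: sqrt_continuous.
have near_bound : \forall tau \near within T +oo,
    `|avg_search_prob R (k tau) (a tau) - 1 / 4| <= 2 * (s tau + Num.sqrt (s tau)).
  have inT : \forall tau \near within T +oo, T tau by exact: withinT.
  have k3 : \forall tau \near within T +oo, (3 <= k tau)%N.
    by move/cvgnyPge: k_infty; apply.
  have delta_small : \forall tau \near within T +oo, 4 * d%:R ^+ 2 * ratio tau <= 1 / 4.
    by apply: (cvgr_le _ delta_lim); rewrite divr_gt0.
  near=> tau.
  have Ttau : T tau by near: tau.
  have [conn _] := X_dr _ Ttau.
  have d_gt0 : (0 < diameter (X tau))%N by rewrite X_diam //; apply: leq_trans hd.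
  have lt_k := valency_lt_card (X_reg _ Ttau) (a tau).
  have n4 : 4 <= #|X tau|%:R :> R.
    rewrite ler_nat; apply: leq_trans lt_k; rewrite ltnS; near: tau.
    exact: k3.
  have := search_prob_near_quarter conn (X_reg _ Ttau) (X_inter _ Ttau) d_gt0 (a tau) n4.
  rewrite X_diam // -/(ratio tau); set s' := _^-1 + _.
  have s's : s' <= s tau.
    by rewrite lerD2r /harmonic lef_pV2 ?posrE ?ltr0n ?ler_nat // (leq_trans _ lt_k).
  move=> est; apply: le_trans (est _) _; first by near: tau.
  by rewrite ler_pM2l // lerD // ler_wsqrtr.
apply: (@squeeze_cvgr _ _ _ _
  (fun tau => 1 / 4 - 2 * (s tau + Num.sqrt (s tau)))
  (fun tau => 1 / 4 + 2 * (s tau + Num.sqrt (s tau)))).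
- near=> tau.
  have : `|avg_search_prob R (k tau) (a tau) - 1 / 4| <= 2 * (s tau + Num.sqrt (s tau)).
    by near: tau.
  by rewrite ler_distl.
- by rewrite -[X in _ --> X]subr0; apply: cvgB => //; exact: cvg_cst.
- by rewrite -[X in _ --> X]addr0; apply: cvgD => //; exact: cvg_cst.
Unshelve. all: by end_near.
Qed.
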